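(* Every countable ordinal $\alpha>0$ is determinate: for every MLO formula $\varphi(X_1,X_2)$, one of the players has a winning strategy in the McNaughton game $\mathcal{G}^\alpha_\varphi$.
   Context: MLO is monadic second-order logic over the signature $\{<\}$. For an ordinal $\gamma>0$ and an MLO formula $\varphi(X_1,X_2)$, the McNaughton game $\mathcal{G}^\gamma_\varphi$ has $\gamma$ rounds: at round $\delta<\gamma$ Player I first chooses $\pi_1(\delta)\in\{0,1\}$ and then Player II chooses $\pi_2(\delta)\in\{0,1\}$; with $P=\pi_1^{-1}(1)$, $Q=\pi_2^{-1}(1)$, Player I wins iff $(\gamma,<)\models\varphi(P,Q)$. A strategy of Player I is a strongly causal map $f:\mathcal{P}(\gamma)\to\mathcal{P}(\gamma)$ ($Q\cap[0,\delta)=Q'\cap[0,\delta)$ implies $f(Q)\cap[0,\delta]=f(Q')\cap[0,\delta]$), winning iff $(\gamma,<)\models\varphi(f(Q),Q)$ for all $Q$; a strategy of Player II is a causal map (hypothesis $P\cap[0,\delta]=P'\cap[0,\delta]$), winning iff $(\gamma,<)\models\neg\varphi(P,f(P))$ for all $P$. *)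

(* Defs.v *)
From mathcomp Require Export all_boot all_order.
From mathcomp Require Export boolp classical_sets functions cardinality.

Set Implicit Arguments.
Unset Strict Implicit.
Unset Printing Implicit Defensive.

Import Order.TTheory.
Local Open Scope order_scope.
Local Open Scope classical_set_scope.

(* An ordinal is represented by a well-ordered type: an [orderType] (total
   order) whose strict order is well founded.  All notions below only depend
   on the order, hence are invariant under order isomorphism. *)
Definition well_ordered (d : Order.disp_t) (T : orderType d) : Prop :=
  well_founded (fun x y : T => x < y).

(* MLO formulas over the signature {<}, in well-scoped de Bruijn form:
   [mlo n m] is the type of formulas with free first-order variables among
   x_0, ..., x_(n-1) and free set variables among X_0, ..., X_(m-1).  A
   quantifier binds index 0 of its body and shifts the other indices of the
   same sort by one.  Conjunction, implication and universal quantifiers are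
   the usual classical abbreviations. *)
Inductive mlo (n m : nat) : Type :=
| Less (i j : 'I_n)
| Equal (i j : 'I_n)
| Member (j : 'I_m) (i : 'I_n)
| Neg (phi : mlo n m)
| Or (phi psi : mlo n m)
| Exists1 (phi : mlo n.+1 m)
| Exists2 (phi : mlo n m.+1).

Fixpoint sat (d : Order.disp_t) (T : orderType d) (n m : nat) (phi : mlo n m) :
    n.-tuple T -> m.-tuple (set T) -> Prop :=
  match phi with
  | Less i j => fun e _ => tnth e i < tnth e j
  | Equal i j => fun e _ => tnth e i = tnth e j
  | Member j i => fun e E => tnth E j (tnth e i)
  | Neg phi => fun e E => ~ sat phi e E
  | Or phi psi => fun e E => sat phi e E \/ sat psi e E
  | Exists1 phi => fun e E => exists x : T, sat phi [tuple of x :: e] E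
  | Exists2 phi => fun e E => exists X : set T, sat phi e [tuple of X :: E]
  end.

(* The play (pi_1, pi_2) is identified with the pair of sets
   P = pi_1^-1(1), Q = pi_2^-1(1).  The two free set variables of phi, at
   de Bruijn indices 0 and 1, are interpreted by P and Q respectively. *)
Definition player1_wins (d : Order.disp_t) (T : orderType d) (phi : mlo 0 2)
    (P Q : set T) : Prop :=
  sat phi [tuple] [tuple P; Q].

Definition causal (d : Order.disp_t) (T : orderType d) (f : set T -> set T) :
    Prop :=
  forall (P P' : set T) (x : T),
    P `&` [set y | y <= x] = P' `&` [set y | y <= x] ->
    f P `&` [set y | y <= x] = f P' `&` [set y | y <= x].

Definition strongly_causal (d : Order.disp_t) (T : orderType d)
    (f : set T -> set T) : Prop :=
  forall (Q Q' : set T) (x : T),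
    Q `&` [set y | y < x] = Q' `&` [set y | y < x] ->
    f Q `&` [set y | y <= x] = f Q' `&` [set y | y <= x].

Definition player1_winning_strategy (d : Order.disp_t) (T : orderType d)
    (phi : mlo 0 2) (f : set T -> set T) : Prop :=
  strongly_causal f /\ forall Q : set T, player1_wins phi (f Q) Q.

Definition player2_winning_strategy (d : Order.disp_t) (T : orderType d)
    (phi : mlo 0 2) (f : set T -> set T) : Prop :=
  causal f /\ forall P : set T, ~ player1_wins phi P (f P).

Definition determinate (d : Order.disp_t) (T : orderType d) : Prop :=
  forall phi : mlo 0 2,
    (exists f : set T -> set T, player1_winning_strategy phi f) \/
    (exists f : set T -> set T, player2_winning_strategy phi f).

(* Main.v *)
Require Import Defs.
From mathcomp Require Import zify.

(* Fix a quantifier depth and consider, on each subset D of T, the games whose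
   winning condition only depends on the finite MLO-type of (D, P, Q).  The key
   point is that determinacy of all these games passes from pieces D_0 < D_1 <
   ... to their union; well-founded induction then gives all subsets of T, since
   by countability every subset is an omega-sum of pieces bounded in it.

   For the omega-sum, player I announces in round i a set W of types that he can
   enforce on D_i, and player II answers with a play on D_i whose type is in W.
   By Ramsey's theorem and Shelah's composition method the type of the whole
   play is determined by a factorization of the sequence of types, and in a
   finite semigroup the existence of such a factorization is a Sigma^0_3
   condition.  So this omega-game is determined by Davis' theorem, and by
   determinacy of the pieces a winning strategy in it can be played in the
   original game. *)

Set Implicit Arguments.
Unset Strict Implicit.
Unset Printing Implicit Defensive.

Import Order.TTheory.
Local Open Scope classical_set_scope.

(** * Davis' theorem: games of length omega with a Sigma^0_3 payoff *)

Section Games.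
Variables (A B : Type) (a0 : A).

Let M := (A * B)%type.
Implicit Types (x y : nat -> M) (p q r : seq M) (W : set (seq M)).
Implicit Types (X : set (nat -> M)) (s : seq M -> A).

(* Latest move first. *)
Fixpoint history (U : Type) (x : nat -> U) n : seq U :=
  if n is m.+1 then x m :: history x m else [::].

Lemma size_history (U : Type) (x : nat -> U) n : size (history x n) = n.
Proof. by elim: n => //= n ->. Qed.

Lemma history_le x y i n : i <= n -> history x n = history y n ->
  history x i = history y i.
Proof.
move=> /subnK <-; elim: (n - i) => // k IH [_]; exact: IH.
Qed.

(** The suffixes of [q] are its earlier positions; the earliest one in [P] is found, so that a
    strategy can recompute where it switched. *)
Fixpoint first_hit (P : set (seq M)) q : option (seq M) :=
  if q is m :: q' then
    if first_hit P q' is Some r then Some r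
    else if `[< P q >] then Some q else None
  else if `[< P q >] then Some q else None.

Lemma first_hit_none P x n : (forall i, i <= n -> ~ P (history x i)) ->
  first_hit P (history x n) = None.
Proof.
elim: n => [|n IH] nP /=; first by rewrite asboolF //; exact: (nP 0).
rewrite IH => [|i /leqW]; last exact: nP.
by rewrite asboolF //; exact: (nP n.+1).
Qed.

Lemma first_hit_some P x j i : P (history x j) ->
  (forall i, i < j -> ~ P (history x i)) -> j <= i ->
  first_hit P (history x i) = Some (history x j).
Proof.
move=> Pj nP /subnK <-; elim: (i - j) => [|k IH]; last by rewrite /= IH.
rewrite add0n; case: j Pj nP => [|j] Pj nP /=; first by rewrite asboolT.
by rewrite first_hit_none ?asboolT.
Qed.

Lemma least_or_never (P : nat -> Prop) :
  (forall n, ~ P n) \/ exists j, P j /\ forall i, i < j -> ~ P i.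
Proof.
case: (pselect (exists n, P n)) => [exP|nP]; last first.
  by left=> n Pn; apply: nP; exists n.
right; have exP' : exists n, `[< P n >] by case: exP => n /asboolP; exists n.
case: (ex_minnP exP') => j /asboolP Pj min; exists j; split=> // i ij /asboolP/min.
by rewrite leqNgt ij.
Qed.

Definition play_from W p x :=
  history x (size p) = p /\ forall n, size p <= n -> W (history x n.+1).

Definition follows s p x :=
  forall n, size p <= n -> (x n).1 = s (history x n).

(* Only the moves of the second player are restricted by the tree [W], which
   need not have any particular shape: pruning it weakens the second player. *)
Definition wins_from W X p :=
  exists s, forall x, play_from W p x -> follows s p x -> X x.

Lemma play_from_later W p x n : play_from W p x -> size p <= n ->
  play_from W (history x n) x.
Proof.
move=> [_ Wx] pn; split; rewrite size_history // => m nm.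
exact/Wx/(leq_trans pn).
Qed.

Lemma wins_from_choice W (X : seq M -> set (nat -> M)) : exists S : seq M -> seq M -> A,
  forall p, wins_from W (X p) p ->
    forall x, play_from W p x -> follows (S p) p x -> X p x.
Proof.
suff /choice[S SP] : forall p, exists s, wins_from W (X p) p ->
    forall x, play_from W p x -> follows s p x -> X p x by exists S.
move=> p; case: (pselect (wins_from W (X p) p)) => [[s sP]|nw]; first by exists s.
by exists (fun=> a0).
Qed.

(** Player I follows [s] until the first winning position, then the strategy chosen there;
    [first_hit] keeps that choice fixed for the rest of the play. *)
Lemma wins_from_switch W X p s :
  (forall x, play_from W p x -> follows s p x ->
     X x \/ exists2 n, size p <= n & wins_from W X (history x n)) ->
  wins_from W X p.
Proof.
move=> sP; have [S SP] := wins_from_choice W (fun=> X).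
pose hit : set (seq M) := fun q => size p <= size q /\ wins_from W X q.
exists (fun q => if first_hit hit q is Some r then S r q else s q) => x px fx.
case: (least_or_never (fun n => hit (history x n))) => [nhit|[j [[pj wj] nhit]]].
  have fsx : follows s p x.
    by move=> n pn; rewrite (fx _ pn) first_hit_none.
  case: (sP x px fsx) => // -[n pn wn]; case: (nhit n).
  by split; rewrite ?size_history.
rewrite size_history in pj; apply: (SP _ wj); first exact: play_from_later px pj.
move=> n; rewrite size_history => jn.
rewrite (fx _ (leq_trans pj jn)) (first_hit_some _ nhit jn) //.
by split; rewrite ?size_history.
Qed.

Lemma nwins_from_step W X p a : ~ wins_from W X p ->
  exists b, W ((a, b) :: p) /\ ~ wins_from W X ((a, b) :: p).
Proof.
move=> nw; apply/not_existsP => nb; apply: nw.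
apply: (@wins_from_switch _ _ _ (fun=> a)) => x [xp Wx] fx; right.
exists (size p).+1 => //=; have := Wx _ (leqnn _); rewrite /= xp.
have := fx _ (leqnn _); case: (x _) => a' b /= -> Wab.
by apply: contrapT => nw; apply: (nb b).
Qed.

(** * Davis' lemma: avoiding a Pi^0_2 part of the payoff *)

Section PiTwo.
Variables (W : set (seq M)) (X : set (nat -> M)) (O : nat -> set (seq M)).
Hypothesis O_up : forall n m q, O n q -> O n (m :: q).
Hypothesis OX : forall x, (forall n, exists i, O n (history x i)) -> X x.

Lemma O_history n x i j : i <= j -> O n (history x i) -> O n (history x j).
Proof.
by move=> /subnK <- Oi; elim: (j - i) => // k IH; rewrite addSn; exact: O_up.
Qed.

(** Player II can prune the tree so that every play misses the intersection of the [O n], without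
    giving player I a win. *)
Definition avoidable p := exists W', [/\ W' `<=` W,
  forall x, play_from W' p x -> exists n, forall i, ~ O n (history x i) &
  ~ wins_from W' X p].

Definition bad_entry n p : set (nat -> M) := fun x =>
  exists m, [/\ size p < m, ~ avoidable (history x m) & O n (history x m)].

(* Player II may stay in the positions where I does not win [X `|` bad_entry n p]
   until [O n] holds, then avoid the intersection of the [O n] from there. *)
Lemma wins_or_bad_entry n p : ~ avoidable p -> wins_from W (X `|` bad_entry n p) p.
Proof.
apply: contraPP => nw; apply.
have /choice[V VP] : forall q, exists W', avoidable q -> [/\ W' `<=` W,
    forall x, play_from W' q x -> exists n, forall i, ~ O n (history x i) &
    ~ wins_from W' X q].
  by move=> q; case: (pselect (avoidable q)) => [[W' W'P]|nq]; [exists W'|exists set0].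
pose E := X `|` bad_entry n p.
pose entry : set (seq M) := fun q => size p < size q /\ O n q.
(* Because of [behead], the move that produces an entry is still judged by the first phase; only
   later moves must stay in [V r]. *)
pose W' : set (seq M) := fun q => W q /\
  if first_hit entry (behead q) is Some r then V r q else ~ wins_from W E q.
have W'none x i : (forall j, j <= i -> ~ entry (history x j)) ->
    W' (history x i.+1) <-> W (history x i.+1) /\ ~ wins_from W E (history x i.+1).
  by move=> ne; rewrite /W' /= first_hit_none.
have W'some x j i : entry (history x j) ->
    (forall i, i < j -> ~ entry (history x i)) -> j <= i ->
    W' (history x i.+1) <-> W (history x i.+1) /\ V (history x j) (history x i.+1).
  by move=> ej nj ji; rewrite /W' /= (first_hit_some ej nj).
(* Every continuation of an unavoidable entry already lies in [bad_entry n p], so there player I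
   wins [E] with any strategy. *)
have entry_good x j : entry (history x j) ->
    ~ wins_from W E (history x j) -> avoidable (history x j).
  move=> [pj Oj]; apply: contraPP => nav; apply.
  exists (fun=> a0) => y [yj _] _; right; exists j; rewrite size_history in yj pj.
  by split=> //; rewrite yj.
have nwE x j : entry (history x j) -> (forall i, i < j -> ~ entry (history x i)) ->
    play_from W' p x -> ~ wins_from W E (history x j).
  move=> ej nj [xp W'x]; have [pj _] := ej; rewrite size_history in pj.
  case: j pj ej nj => // j pj ej nj; have /W'none[|_ //] := W'x _ pj.
  by move=> i ij; apply: nj.
exists W'; split; first by move=> q [].
  move=> x px; case: (least_or_never (fun j => entry (history x j))).
    move=> ne; exists n => i /(O_history (leq_maxl i (size p).+1)) Oi.
    apply: (ne (maxn i (size p).+1)); split=> //.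
    by rewrite size_history leq_maxr.
  move=> [j [ej nj]]; have [pj _] := ej; rewrite size_history in pj.
  have /VP[_ + _] := entry_good x j ej (nwE _ _ ej nj px).
  apply; split; rewrite size_history // => i ji.
  have /(W'some _ _ _ ej nj ji)[] // := px.2 i (leq_trans (ltnW pj) ji).
(* If [s] won [X] in [W'], player I could win [E] in [W]: he plays [s] and switches once [E] is
   winnable. Without a switch the play either stays in [W'], or has an avoidable first entry, from
   which [s] would win [X] inside [V]. *)
case=> s sP; apply: nw; apply: (@wins_from_switch _ _ _ s) => x px fx.
apply: contrapT => /not_orP[nE nwx].
have {}nwx i : size p <= i -> ~ wins_from W E (history x i).
  by move=> pi wi; apply: nwx; exists i.
case: (least_or_never (fun j => entry (history x j))) => [ne|[j [ej nj]]].
  apply: nE; left; apply: sP => //; split; first exact: px.1.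
  move=> i pi; apply/W'none => [//|]; split; first exact: px.2.
  by apply: nwx; apply: leqW.
have [pj _] := ej; rewrite size_history in pj.
have /VP[_ _] := entry_good x j ej (nwx j (ltnW pj)).
apply; exists s => y [yj Vy] fy; rewrite size_history in yj Vy.
have yx i : i <= j -> history y i = history x i by move=> ij; exact: history_le yj.
apply: sP.
  split; first by rewrite yx ?px.1 // ltnW.
  move=> i pi; case: (leqP j i) => ji.
    apply/(W'some y j); [by rewrite yj|by move=> k kj; rewrite yx ?(ltnW kj)//; apply: nj|done|].
    rewrite yj; split; last exact: Vy.
    by have /VP[+ _ _] := entry_good x j ej (nwx j (ltnW pj)); apply; exact: Vy.
  apply/W'none => [k ki|].
    by rewrite yx; [apply: nj; apply: leq_ltn_trans ji|apply: leq_trans ki (ltnW ji)].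
  by rewrite yx //; split; [exact: px.2|apply: nwx; apply: leqW].
move=> i pi; case: (leqP j i) => ji; first by apply: fy; rewrite size_history.
have := yx _ ji; rewrite /= => -[-> ->]; exact: fx.
Qed.

(* From an unavoidable position, I plays for [X `|` bad_entry 0 p], restarts with
   [bad_entry 1] at the first bad entry, and so on: either he wins [X] within a
   stage, or all [O n] hold. *)
Lemma nwins_from_avoidable p : ~ wins_from W X p -> avoidable p.
Proof.
apply: contraPP => nav; apply.
have /choice[S SP] : forall n, exists S : seq M -> seq M -> A, forall q, ~ avoidable q ->
    forall x, play_from W q x -> follows (S q) q x -> (X `|` bad_entry n q) x.
  move=> n; have [S SP] := wins_from_choice W (fun q => X `|` bad_entry n q).
  by exists S => q /(@wins_or_bad_entry n); apply: SP.
pose leave n q := ~ avoidable q /\ O n q.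
(* The position where the current stage began, and the number of that stage. *)
pose fix stage q : seq M * nat := if q is _ :: q' then
    let: (r, n) := stage q' in
    if `[< size p < size q /\ leave n q >] then (q, n.+1) else (r, n)
  else (p, 0).
exists (fun q => S (stage q).2 (stage q).1 q) => x px fx.
have stage_p i : i <= size p -> stage (history x i) = (p, 0).
  elim: i => //= i IH ip; rewrite (IH (ltnW ip)) asboolF // size_history.
  by case; rewrite ltnNge ip.
have stage_const i j rn : size p <= i -> i <= j ->
    (forall k, i < k -> k <= j -> ~ leave rn.2 (history x k)) ->
    stage (history x i) = rn -> stage (history x j) = rn.
  move=> pi /subnK <- + si; elim: (j - i) => // k IH nl.
  rewrite /= IH; last by move=> l il lk; apply: nl => //; apply: leqW.
  case: rn {si IH} nl => r n /= nl; rewrite asboolF //= => -[_].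
  by apply: (nl (k + i).+1); rewrite ?ltnS ?leq_addl.
apply: contrapT => nX.
(* On a play outside [X] each stage strategy guarantees a bad entry, so every stage is reached. *)
have reach n : exists i, [/\ size p <= i, stage (history x i) = (history x i, n),
    ~ avoidable (history x i) & if n is m.+1 then O m (history x i) else True].
  elim: n => [|n [i [pi si nai _]]].
    by exists (size p); rewrite stage_p // px.1; split.
  case: (least_or_never (fun m => i < m /\ leave n (history x m))).
    move=> nl; exfalso.
    have sj j : i <= j -> stage (history x j) = (history x i, n).
      move=> ij; apply: (stage_const _ _ _ pi ij _ si) => // k ik _ lk.
      by apply: (nl k).
    have [//||//|[m [im nam Om]]] := SP n _ nai x.
    - exact: play_from_later px pi.
    - move=> j; rewrite size_history => ij; rewrite fx ?sj //.
      exact: leq_trans ij.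
    by apply: (nl m); rewrite size_history in im.
  move=> [m [[im [nam Om]] nl]]; exists m; split=> //.
    exact: leq_trans (ltnW im).
  case: m im nam Om nl => // m im nam Om nl.
  have sm : stage (history x m) = (history x i, n).
    apply: (stage_const _ _ _ pi im _ si) => // k ik km lk.
    by apply: (nl k).
  move=> /=; rewrite sm asboolT // /leave /= size_history; split=> //.
  exact: leq_ltn_trans im.
apply/nX/OX => n; have [i [_ _ _ Oi]] := reach n.+1; by exists i.
Qed.

End PiTwo.

(** At each position of length [k], player II passes to a subtree that avoids the [k]-th Pi^0_2
    piece and in which player I still has no win. On the positions in [R] this is maintained, and
    [t] answers every move legally. *)
Lemma sigma03_determined W X (O : nat -> nat -> set (seq M)) :
  (forall k n m q, O k n q -> O k n (m :: q)) ->
  (forall x, X x <-> exists k, forall n, exists i, O k n (history x i)) ->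
  wins_from W X [::] \/
  exists (t : seq M -> A -> B) (R : set (seq M)), [/\ R [::],
    forall h a, R h -> W ((a, t h a) :: h) /\ R ((a, t h a) :: h) &
    forall x, (forall n, (x n).2 = t (history x n) (x n).1) -> ~ X x].
Proof.
move=> O_up XO; case: (pselect (wins_from W X [::])) => [|nw]; [by left|right].
have /choice[V VP] : forall kVq : nat * set (seq M) * seq M, exists V',
    ~ wins_from kVq.1.2 X kVq.2 -> [/\ V' `<=` kVq.1.2,
    forall x, play_from V' kVq.2 x -> exists n, forall i, ~ O kVq.1.1 n (history x i) &
    ~ wins_from V' X kVq.2].
  move=> [[k V] q] /=; case: (pselect (wins_from V X q)) => [wq|]; first by exists set0.
  move=> /(@nwins_from_avoidable _ _ (O k))[||V' V'P]; last by exists V'.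
  - exact: O_up.
  - by move=> x xO; apply/XO; exists k.
pose fix tree q := if q is _ :: q' then V (size q, tree q', q) else V (0, W, [::]).
(* A default reply: player II has one because player I does not win. *)
have b0 : B by have [b _] := cid (nwins_from_step a0 nw).
have /choice[t0 t0P] : forall qa : seq M * A, exists b,
    ~ wins_from (tree qa.1) X qa.1 ->
    tree qa.1 ((qa.2, b) :: qa.1) /\ ~ wins_from (tree qa.1) X ((qa.2, b) :: qa.1).
  move=> [q a] /=; case: (pselect (wins_from (tree q) X q)) => [|nwq]; first by exists b0.
  by have [b bP] := nwins_from_step a nwq; exists b.
pose t q a := t0 (q, a).
pose R q := tree q `<=` W /\ ~ wins_from (tree q) X q.
have R0 : R [::] by have [] := VP (0, W, [::]) nw.
have Rstep h a : R h -> [/\ tree h ((a, t h a) :: h),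
    tree ((a, t h a) :: h) `<=` tree h & R ((a, t h a) :: h)].
  move=> [hW nwh]; have [th nwt] := t0P (h, a) nwh; split=> //.
    by have [] := VP ((size h).+1, tree h, (a, t h a) :: h) nwt.
  by have [tt _ nwt'] := VP ((size h).+1, tree h, (a, t h a) :: h) nwt; split=> // q /tt /hW.
exists t, R; split=> // [h a Rh|x xt].
  have [th _ Rth] := Rstep h a Rh; split=> //; exact: Rh.1.
have xE n : history x n.+1 = ((x n).1, t (history x n) (x n).1) :: history x n.
  by rewrite /= -xt; case: (x n).
have Rx n : R (history x n).
  by elim: n => [//|n IH]; rewrite xE; have [] := Rstep _ (x n).1 IH.
have tree_dec n m : n <= m -> tree (history x m) `<=` tree (history x n).
  move=> /subnK <-; elim: (m - n) => // k IH; rewrite xE.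
  by have [_ tt _] := Rstep _ (x (k + n)).1 (Rx (k + n)) => q /tt /IH.
have from_tree n : play_from (tree (history x n)) (history x n) x.
  split; rewrite size_history // => m nm; apply: (tree_dec _ _ nm).
  by rewrite xE; have [] := Rstep _ (x m).1 (Rx m).
case/XO => k xO.
have [n nO] : exists n, forall i, ~ O k n (history x i).
  case: k {xO} (from_tree k) => [f0|k fk].
    by have [_ /(_ _ f0)] := VP (0, W, [::]) nw.
  move: fk; rewrite xE => fk.
  have [_ nwt] := t0P (history x k, (x k).1) (Rx k).2.
  have [_ /(_ x)] := VP (k.+1, tree (history x k), _ :: history x k) nwt.
  rewrite -/(t _ _) /= in fk *; rewrite size_history in fk; by move=> /(_ fk).
by have [i] := xO n; apply: nO.
Qed.

End Games.

(** * Types and the composition method *)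

Local Open Scope order_scope.
Local Open Scope classical_set_scope.

(** Hintikka types: atomic facts about [k] sets at depth 0, then sets of types realized by adding
    one more set. Finiteness is what Ramsey's theorem needs. *)
Fixpoint mso_type (n k : nat) : finType :=
  if n is n'.+1 then ({set mso_type n' k.+1} : finType)
  else ({ffun 'I_k * 'I_k -> bool * bool} : finType).

Definition scons (U : Type) (a : U) (s : nat -> U) : nat -> U :=
  fun i => if i is j.+1 then s j else a.

Section Types.
Variables (d : Order.disp_t) (T : orderType d).
Implicit Types (D Y : set T) (X Z : nat -> set T).

(** With singletons in place of elements, these two atoms express order, equality and membership,
    and also which sets are singletons. *)
Definition some_below (D Y Z : set T) := exists x y, [/\ D x, D y, Y x, Z y & x < y].
Definition some_common (D Y Z : set T) := exists x, [/\ D x, Y x & Z x].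

Fixpoint type_of (n k : nat) D X : mso_type n k :=
  match n return mso_type n k with
  | 0 => [ffun ij : 'I_k * 'I_k => (`[< some_below D (X ij.1) (X ij.2) >],
                                    `[< some_common D (X ij.1) (X ij.2) >])]
  | n'.+1 => [set t : mso_type n' k.+1 | `[< exists Y, type_of n' k.+1 D (scons Y X) = t >]]%SET
  end.

Lemma type_of0P k D X D' X' : type_of 0 k D X = type_of 0 k D' X' <->
  forall i j, (i < k)%N -> (j < k)%N ->
    (some_below D (X i) (X j) <-> some_below D' (X' i) (X' j)) /\
    (some_common D (X i) (X j) <-> some_common D' (X' i) (X' j)).
Proof.
split=> [/ffunP e i j ik jk|e].
  have := e (Ordinal ik, Ordinal jk); rewrite !ffunE /= => -[e1 e2].
  by split; apply: asbool_eq_equiv.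
apply: (proj1 (@ffunP _ (fun=> _) _ _)) => -[[i ik] [j jk]]; rewrite !ffunE /=.
have [e1 e2] := e i j ik jk.
by congr (_, _); apply: asbool_equiv_eq.
Qed.

Lemma type_of_extend n k D X D' X' Y : type_of n.+1 k D X = type_of n.+1 k D' X' ->
  exists Y', type_of n k.+1 D (scons Y X) = type_of n k.+1 D' (scons Y' X').
Proof.
move=> /setP /(_ (type_of n k.+1 D (scons Y X))); rewrite !inE.
rewrite asboolT; last by exists Y.
by move=> /esym/asboolP[Y' <-]; exists Y'.
Qed.

Lemma type_ofSP n k D X D' X' :
  (forall Y, exists Y', type_of n k.+1 D (scons Y X) = type_of n k.+1 D' (scons Y' X')) ->
  (forall Y', exists Y, type_of n k.+1 D' (scons Y' X') = type_of n k.+1 D (scons Y X)) ->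
  type_of n.+1 k D X = type_of n.+1 k D' X'.
Proof.
move=> e e'; apply/setP => t; rewrite !inE; apply: asbool_equiv_eq; split.
  by move=> [Y <-]; have [Y' eY] := e Y; exists Y'.
by move=> [Y <-]; have [Y' eY] := e' Y; exists Y'.
Qed.

Lemma type_of_local n k D X X' :
  (forall i x, D x -> X i x <-> X' i x) -> type_of n k D X = type_of n k D X'.
Proof.
elim: n k X X' => [|n IH] k X X' e.
  apply/type_of0P => i j _ _; split; split.
  - by move=> [x [y [Dx Dy Xx Xy xy]]]; exists x, y; split=> //; apply/e.
  - by move=> [x [y [Dx Dy Xx Xy xy]]]; exists x, y; split=> //; apply/e.
  - by move=> [x [Dx Xx Xy]]; exists x; split=> //; apply/e.
  - by move=> [x [Dx Xx Xy]]; exists x; split=> //; apply/e.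
by apply: type_ofSP => Y; exists Y; apply: IH => -[|i] x Dx //=; split=> /e; exact.
Qed.

Lemma type_of_atoms n k D X D' X' : type_of n k D X = type_of n k D' X' ->
  forall i j, (i < k)%N -> (j < k)%N ->
    (some_below D (X i) (X j) <-> some_below D' (X' i) (X' j)) /\
    (some_common D (X i) (X j) <-> some_common D' (X' i) (X' j)).
Proof.
elim: n k X X' => [|n IH] k X X'; first by move/type_of0P.
move=> /(@type_of_extend _ _ _ _ _ _ set0)[Y' /IH e] i j ik jk.
exact: (e i.+1 j.+1).
Qed.

(** * Ordered sums of pieces *)

Definition ordered_pieces (D : nat -> set T) :=
  forall i j, (i < j)%N -> forall x y, D i x -> D j y -> x < y.

Lemma ordered_pieces_inj (D : nat -> set T) i j x :
  ordered_pieces D -> D i x -> D j x -> i = j.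
Proof.
by move=> oD Di Dj; case: (ltngtP i j) => // ij;
  [have := oD _ _ ij _ _ Di Dj|have := oD _ _ ij _ _ Dj Di]; rewrite ltxx.
Qed.

Definition glue (D Y : nat -> set T) : set T := fun x => exists2 i, D i x & Y i x.

Lemma glueE (D Y : nat -> set T) i x :
  ordered_pieces D -> D i x -> glue D Y x <-> Y i x.
Proof.
move=> oD Di; split=> [[j Dj Yj]|Yi]; last by exists i.
by rewrite (ordered_pieces_inj oD Di Dj).
Qed.

(* Shelah's composition theorem for sums of order type omega. *)
Lemma type_of_bigcup n k (D D' : nat -> set T) X X' :
  ordered_pieces D -> ordered_pieces D' ->
  (forall i, type_of n k (D i) X = type_of n k (D' i) X') ->
  type_of n k (\bigcup_i D i) X = type_of n k (\bigcup_i D' i) X'.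
Proof.
elim: n k D D' X X' => [|n IH] k D D' X X' oD oD' e.
  have imp1 E E' Z Z' : ordered_pieces E -> ordered_pieces E' ->
      (forall i, type_of 0 k (E i) Z = type_of 0 k (E' i) Z') ->
      forall i j, (i < k)%N -> (j < k)%N ->
      some_below (\bigcup_i E i) (Z i) (Z j) -> some_below (\bigcup_i E' i) (Z' i) (Z' j).
    move=> oE oE' eE i j ik jk [x [y [[a _ Ex] [b _ Ey] Zx Zy xy]]].
    case: (ltngtP a b) => [ab|ba|ab].
    (* Across different pieces only non-emptiness of each set on its piece matters, which is the
       atom [some_common] of a set with itself. *)
    - have [/type_of0P ea /type_of0P eb] := (eE a, eE b).
      have [_ [+ _]] := ea _ _ ik ik => -[|x' [Ex' Zx' _]]; first by exists x.
      have [_ [+ _]] := eb _ _ jk jk => -[|y' [Ey' Zy' _]]; first by exists y.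
      exists x', y'; split=> //; [by exists a|by exists b|].
      exact: oE' ab _ _ Ex' Ey'.
    - by have := oE _ _ ba _ _ Ey Ex; rewrite lt_gtF.
    - have /type_of0P/(_ _ _ ik jk)[[+ _] _] := eE a.
      case=> [|x' [y' [Ex' Ey' Zx' Zy' xy']]].
        by exists x, y; split=> //; rewrite ab.
      by exists x', y'; split=> //; exists a.
  have imp2 E E' Z Z' :
      (forall i, type_of 0 k (E i) Z = type_of 0 k (E' i) Z') ->
      forall i j, (i < k)%N -> (j < k)%N ->
      some_common (\bigcup_i E i) (Z i) (Z j) -> some_common (\bigcup_i E' i) (Z' i) (Z' j).
    move=> eE i j ik jk [x [[a _ Ex] Zi Zj]].
    have /type_of0P/(_ _ _ ik jk)[_ [+ _]] := eE a.
    case=> [|x' [Ex' Zi' Zj']]; first by exists x.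
    by exists x'; split=> //; exists a.
  apply/type_of0P => i j ik jk; split; split.
  - exact: imp1.
  - exact: imp1.
  - exact: imp2.
  - exact: imp2.
have ext E E' Z Z' : ordered_pieces E -> ordered_pieces E' ->
    (forall i, type_of n.+1 k (E i) Z = type_of n.+1 k (E' i) Z') ->
    forall Y, exists Y', type_of n k.+1 (\bigcup_i E i) (scons Y Z) =
                         type_of n k.+1 (\bigcup_i E' i) (scons Y' Z').
  move=> oE oE' eE Y.
  (* The answer to [Y] is found on each piece separately and then glued. *)
  have /choice[Y' Y'P] i := type_of_extend Y (eE i).
  exists (glue E' Y'); apply: IH => // i; rewrite Y'P.
  by apply: type_of_local => -[|j] x Ex //=; apply: iff_sym; exact: glueE.
by apply: type_ofSP; apply: ext.
Qed.

(** A binary sum becomes an omega-sum by padding with empty pieces. *)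
Definition two_pieces (D E : set T) i :=
  if i is j.+1 then if j is 0 then E else set0 else D.

Lemma bigcup_two_pieces (D E : set T) : \bigcup_i two_pieces D E i = D `|` E.
Proof.
apply/seteqP; split=> x; last by case=> ?; [exists 0%N|exists 1%N].
by move=> [[|[|i]] _ //=]; [left|right].
Qed.

Lemma ordered_two_pieces (D E : set T) :
  (forall x y, D x -> E y -> x < y) -> ordered_pieces (two_pieces D E).
Proof. by move=> DE [|[|i]] [|[|j]]. Qed.

Lemma type_of_setU n k D E D' E' X X' :
  (forall x y, D x -> E y -> x < y) -> (forall x y, D' x -> E' y -> x < y) ->
  type_of n k D X = type_of n k D' X' -> type_of n k E X = type_of n k E' X' ->
  type_of n k (D `|` E) X = type_of n k (D' `|` E') X'.
Proof.
move=> DE D'E' eD eE; rewrite -!bigcup_two_pieces.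
apply: type_of_bigcup; [exact: ordered_two_pieces|exact: ordered_two_pieces|].
by case=> [|[|i]] //=; apply: type_of_local.
Qed.

(** * Types decide formulas *)

Fixpoint qdepth n m (phi : mlo n m) : nat :=
  match phi with
  | Less _ _ | Equal _ _ | Member _ _ => 0
  | Neg phi => qdepth phi
  | Or phi psi => maxn (qdepth phi) (qdepth psi)
  | Exists1 phi => (qdepth phi).+1
  | Exists2 phi => (qdepth phi).+1
  end.

Lemma some_below1 (x y : T) : some_below setT [set x] [set y] <-> x < y.
Proof.
by split=> [[x' [y' [_ _ -> ->]]]//|xy]; exists x, y.
Qed.

Lemma some_common1 Y (x : T) : some_common setT Y [set x] <-> Y x.
Proof. by split=> [[x' [_ Yx <-]] //|xy]; exists x. Qed.

Lemma singletonP Y : (exists x, Y = [set x]) <->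
  some_common setT Y Y /\ ~ some_below setT Y Y.
Proof.
split=> [[x ->]|[[x [_ Yx _]] nb]].
  by split; [exists x|move/some_below1; rewrite ltxx].
exists x; apply/seteqP; split=> [y Yy|y ->//].
by case: (ltgtP x y) => // xy; case: nb; [exists x, y|exists y, x].
Qed.

(* First-order variables are represented among the [X i] by singletons; [u]
   and [w] locate the first-order and set variables of [phi]. *)
Lemma sat_type_of n m (phi : mlo n m) N k (u : 'I_n -> nat) (w : 'I_m -> nat) :
  (qdepth phi <= N)%N -> (forall i, (u i < k)%N) -> (forall j, (w j < k)%N) ->
  forall X X' e E e' E',
    (forall i, X (u i) = [set tnth e i]) -> (forall j, X (w j) = tnth E j) ->
    (forall i, X' (u i) = [set tnth e' i]) -> (forall j, X' (w j) = tnth E' j) ->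
    type_of N k setT X = type_of N k setT X' -> sat phi e E -> sat phi e' E'.
Proof.
elim: phi N k u w => {n m} [n m i j|n m i j|n m j i|n m phi IH|n m phi IH psi IH'|n m phi IH|n m phi IH]
  N k u w /= dN uk wk X X' e E e' E' Xe XE Xe' XE' eX.
- have [+ _] := type_of_atoms eX (uk i) (uk j).
  by rewrite !Xe !Xe' !some_below1 => -[].
- have [_] := type_of_atoms eX (uk i) (uk j).
  by rewrite !Xe !Xe' !some_common1 /= => -[+ _] ij; rewrite -ij => ->.
- have [_] := type_of_atoms eX (wk j) (uk i).
  by rewrite !Xe !Xe' !some_common1 /= XE XE' => -[].
- move=> ns s; apply: ns; move/esym: eX s; exact: IH.
- rewrite geq_max in dN; have [dN1 dN2] := andP dN.
  by case=> s; [left; apply: IH eX s|right; apply: IH' eX s].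
- case: N dN eX => // N dN eX [x sx].
  have [Y' eY] := type_of_extend [set x] eX.
  (* The answer to a singleton is a singleton, since the atoms detect singletons. *)
  have [x' Y'x] : exists x', Y' = [set x'].
    apply/singletonP; have [e1 e2] := type_of_atoms eY (ltn0Sn _) (ltn0Sn _).
    rewrite -(e1 : some_below _ [set x] _ <-> _) -(e2 : some_common _ [set x] _ <-> _).
    by apply/singletonP; exists x.
  exists x'; rewrite {}Y'x in eY.
  apply: (IH N k.+1 (fun i => if unlift ord0 i is Some j then (u j).+1 else 0%N)
               (fun j => (w j).+1)) eY sx => //.
  + by move=> i; case: unliftP => [j _|_] //=; rewrite ltnS.
  + move=> i; case: unliftP => [j ->|->]; last by rewrite tnth0.
    by rewrite tnthS /=.
  + move=> i; case: unliftP => [j ->|->]; last by rewrite tnth0.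
    by rewrite tnthS /=.
- case: N dN eX => // N dN eX [Y sY].
  have [Y' eY] := type_of_extend Y eX.
  exists Y'.
  apply: (IH N k.+1 (fun i => (u i).+1)
     (fun i => if unlift ord0 i is Some j then (w j).+1 else 0%N)) eY sY => //.
  + by move=> i; case: unliftP => [j _|_] //=; rewrite ltnS.
  + move=> i; case: unliftP => [j ->|->]; last by rewrite tnth0.
    by rewrite tnthS /=.
  + move=> i; case: unliftP => [j ->|->]; last by rewrite tnth0.
    by rewrite tnthS /=.
Qed.

End Types.

(** * Ramsey's theorem *)

Section Ramsey.
Local Open Scope nat_scope.
Variable S : finType.

Lemma infinite_pigeonhole (f : nat -> S) (P : nat -> Prop) :
  (forall N, exists2 m, N < m & P m) ->
  exists e, forall N, exists2 m, N < m & P m /\ f m = e.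
Proof.
move=> iP; apply: contrapT => /forallNP ne.
have /choice[N NP] : forall e, exists N, forall m, N < m -> P m -> f m <> e.
  move=> e; have /existsNP[N nN] := ne e; exists N => m Nm Pm fm.
  by apply: nN; exists m.
have [m Nm Pm] := iP (\max_e N e).
exact: (NP (f m) m (leq_ltn_trans (leq_bigmax _) Nm) Pm).
Qed.

Variable c : nat -> nat -> S.
(* [k] and [m] merge when [c k m' = c m m'] for some [m' > m]; a set of
   indices no two of which merge has at most [#|S|] elements. *)
Lemma merging_ramsey : exists k e, forall N, exists m m',
  [/\ N < m, m < m', c k m = e & c k m' = c m m'].
Proof.
have [k kP] : exists k, forall N, exists2 m, N < m & exists2 m', m < m' & c k m' = c m m'.
  apply: contrapT => /forallNP nk.
  have /choice[N NP] : forall k, exists N, forall m, N < m ->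
      forall m', m < m' -> c k m' <> c m m'.
    move=> k; have /existsNP[N nN] := nk k; exists N => m Nm m' mm' cm.
    by apply: nN; exists m => //; exists m'.
  (* Each [a j] lies beyond [N (a i)] for all [i < j]; the second component of [ab] dominates these
     bounds. No two terms merge, so against [L] they would show [#|S|.+1] distinct colours. *)
  pose ab := fix ab i := if i is j.+1 then
      let a := (ab j).2.+1 in (a, maxn (ab j).2 (maxn a (N a)))
    else (0, N 0).
  pose a i := (ab i).1.
  have Na i j : i < j -> N (a i) < a j /\ a i < a j.
    have abN k l : l <= k -> N (a l) <= (ab k).2 /\ a l <= (ab k).2.
      elim: k => [|k IH]; first by rewrite leqn0 => /eqP ->.
      by rewrite leq_eqVlt => /orP[/eqP ->|/IH[]]; rewrite /a /=; lia.
    by case: j => // j; rewrite ltnS => /abN.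
  pose L := (a #|S|.+1).
  have inj : injective (fun i : 'I_#|S|.+1 => c (a i) L).
    have lt (i j : 'I_#|S|.+1) : (i < j) -> c (a i) L <> c (a j) L.
      move=> ij; apply: NP; first exact: (Na _ _ ij).1.
      exact: (Na _ _ (ltn_ord j)).2.
    move=> i j cij; apply/val_inj; case: (ltngtP i j) => // ij.
      by case: (lt _ _ ij).
    by case: (lt _ _ ij).
  by have := leq_card _ inj; rewrite card_ord ltnn.
have [e eP] := infinite_pigeonhole (c k) kP.
by exists k, e => N; have [m Nm [[m' mm' cm] ce]] := eP N; exists m, m'.
Qed.

Hypothesis c_right : forall k k' m m', k <= m -> k' <= m -> m <= m' ->
  c k m = c k' m -> c k m' = c k' m'.

(** Each chosen index merges with [k] before the next one is chosen, so by [c_right] the colour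
    between consecutive choices is the colour from [k] to the later one, namely [e]. *)
Lemma merging_factorization k e :
  (forall N, exists m m', [/\ N < m, m < m', c k m = e & c k m' = c m m']) ->
  exists g : nat -> nat, [/\ g 0 = k, forall i, g i < g i.+1 &
    forall i, c (g i) (g i.+1) = e].
Proof.
move=> kP; have /choice[F FP] : forall N, exists mm' : nat * nat,
    [/\ N < mm'.1, mm'.1 < mm'.2, c k mm'.1 = e & c k mm'.2 = c mm'.1 mm'.2].
  by move=> N; have [m [m' ?]] := kP N; exists (m, m').
pose a := fix a i := if i is j.+1 then F (a j).2 else (k, k).
have aP i : [/\ k <= (a i).1, (a i).1 <= (a i).2 & c k (a i).2 = c (a i).1 (a i).2].
  elim: i => [|i [ki ai _]] /=; first by [].
  have [aF FF _ cF] := FP (a i).2; split=> //; lia.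
exists (fun i => (a i).1); split=> // i; have [ki ai ci] := aP i;
  have [aF FF eF _] := FP (a i).2 => /=; first by lia.
by rewrite -eF; apply/esym/(c_right _ _ _ ci); lia.
Qed.

End Ramsey.

(** * Games on subsets of T *)

Section Determinacy.
Variables (d : Order.disp_t) (T : orderType d) (n : nat).
Implicit Types (D P Q Z : set T).

Let ty := mso_type n 2.

Definition play_type D P Q : ty := type_of n 2 D (scons P (scons Q (fun=> set0))).

Lemma play_type_local D P Q P' Q' :
  (forall x, D x -> P x <-> P' x) -> (forall x, D x -> Q x <-> Q' x) ->
  play_type D P Q = play_type D P' Q'.
Proof. by move=> eP eQ; apply: type_of_local => -[|[|i]] x Dx //=; [apply: eP|apply: eQ]. Qed.

Definition forced1 D (C : set ty) :=
  exists f : set T -> set T, strongly_causal f /\ forall Q, C (play_type D (f Q) Q).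

Definition forced2 D (C : set ty) :=
  exists f : set T -> set T, causal f /\ forall P, C (play_type D P (f P)).

Definition determined D := forall C, forced1 D C \/ forced2 D (~` C).

Lemma eq_setIP Z Z' D : Z `&` D = Z' `&` D <-> forall y, D y -> Z y <-> Z' y.
Proof.
split=> [/seteqP[ZZ' Z'Z] y Dy|e].
  by split=> Zy; [case: (ZZ' y)|case: (Z'Z y)].
by apply/seteqP; split=> y [Zy Dy]; split=> //; apply/(e y Dy).
Qed.

Lemma determined_sub1 D (b : T) : D `<=` [set b] -> determined D.
Proof.
move=> Db C; pose v (p q : Prop) := play_type D (fun=> p) (fun=> q).
have vE P Q : play_type D P Q = v (P b) (Q b).
  by apply: play_type_local => x /Db ->.
case: (pselect (exists p, forall q, C (v p q))) => [[p pC]|nC].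
  by left; exists (fun=> (fun=> p)); split=> // Q; rewrite vE.
have /choice[q qP] : forall p, exists q, ~ C (v p q).
  by move=> p; apply/existsNP => pC; apply: nC; exists p.
right; exists (fun P x => q (P x)); split=> [P P' x PP'|P]; last by rewrite vE; apply: qP.
by apply/eq_setIP => y yx; rewrite (propext ((eq_setIP _ _ _).1 PP' y yx)).
Qed.

(** With [<] for [r] this is strong causality, with [<=] causality, so one lemma serves both
    players. *)
Definition causal_wrt (r : T -> T -> Prop) (f : set T -> set T) :=
  forall Z Z' x, Z `&` [set y | r y x] = Z' `&` [set y | r y x] ->
    f Z `&` [set y | y <= x] = f Z' `&` [set y | y <= x].

Section OmegaSum.
Variable D : nat -> set T.
Hypothesis oD : ordered_pieces D.

(** * Strategies played piece by piece *)

Section Play.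
Variables (M : Type) (step : seq M -> set T -> M).

Fixpoint sum_history Z i : seq M :=
  if i is j.+1 then
    let h := sum_history Z j in step h (Z `&` D j) :: h
  else [::].

Definition sum_play Z i : M := step (sum_history Z i) (Z `&` D i).

Lemma history_sum_play Z i : history (sum_play Z) i = sum_history Z i.
Proof. by elim: i => //= i ->. Qed.

Lemma sum_history_eq Z Z' i : (forall j, (j < i)%N -> Z `&` D j = Z' `&` D j) ->
  sum_history Z i = sum_history Z' i.
Proof.
elim: i => //= i IH e; rewrite IH => [|j ji]; last exact/e/leqW.
by rewrite e.
Qed.

(** At a point of piece [i] all earlier pieces lie below, so the history is already known; within
    the piece the causality of [f h] applies. *)
Lemma causal_sum (r : T -> T -> Prop) (f : seq M -> set T -> set T) :
  (forall y x, y < x -> r y x) -> (forall z y x, y <= x -> r z y -> r z x) ->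
  (forall h, causal_wrt r (f h)) ->
  causal_wrt r (fun Z => glue D (fun i => f (sum_history Z i) (Z `&` D i))).
Proof.
move=> r_lt r_le fr.
move=> Z Z' x /eq_setIP e; apply/eq_setIP => y yx.
have eD i z : r z x -> (Z `&` D i) z <-> (Z' `&` D i) z.
  by move=> zx; split=> -[Zz Dz]; split=> //; apply/e.
have sub i : D i y -> f (sum_history Z i) (Z `&` D i) y <->
    f (sum_history Z' i) (Z' `&` D i) y.
  move=> Di; rewrite (@sum_history_eq Z Z') => [|j ji].
    apply: ((eq_setIP _ _ [set z | z <= y]).1 _ y (lexx y)).
    by apply/fr/eq_setIP => z zy; apply/eD/(r_le _ _ _ yx).
  apply/seteqP; split=> z [Zz Dz];
    by apply/eD => //; apply/(r_le _ _ _ yx)/r_lt/(oD ji Dz Di).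
by split=> -[i Di /sub]; exists i => //; tauto.
Qed.

End Play.

(** * Regrouping pieces into blocks *)

Definition seg k m : set T := fun z => exists2 i, (k <= i < m)%N & D i z.

Definition blocks (g : nat -> nat) i : set T :=
  if i is j.+1 then seg (g j) (g j.+1) else seg 0 (g 0%N).

Lemma seg_lt k m k' m' x y : (m <= k')%N -> seg k m x -> seg k' m' y -> x < y.
Proof.
move=> mk [i im Di] [j jm Dj]; apply: oD Di Dj; lia.
Qed.

Lemma segU k m m' : (k <= m)%N -> (m <= m')%N -> seg k m' = seg k m `|` seg m m'.
Proof.
move=> km mm'; apply/seteqP; split=> [z [i im Dz]|z [] [i im Dz]].
- by case: (ltnP i m) => mi; [left|right]; exists i => //; lia.
- by exists i => //; lia.
- by exists i => //; lia.
Qed.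

Section Blocks.
Variable g : nat -> nat.
Hypothesis g_lt : forall i, (g i < g i.+1)%N.

Lemma bigcup_blocks : \bigcup_i blocks g i = \bigcup_i D i.
Proof.
apply/seteqP; split=> [z [[|i] _ [j _ Dz]]|z [i _ Dz]]; [by exists j|by exists j|].
have gi : exists j, (i < g j)%N.
  exists i.+1; elim: {Dz} i => [|i IH]; first by have := g_lt 0; lia.
  by have := g_lt i.+1; lia.
case: (ex_minnP gi) => -[|j] gj min; first by exists 0%N => //; exists i.
exists j.+1 => //; exists i => //; rewrite gj andbT leqNgt.
by apply/negP => /min; rewrite ltnn.
Qed.

Lemma ordered_blocks : ordered_pieces (blocks g).
Proof.
have g_le i j : (i <= j)%N -> (g i <= g j)%N.
  by move=> /subnK <-; elim: (j - i)%N => // k IH; have := g_lt (k + i); rewrite addSn; lia.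
case=> [|i] [|j] // ij x y; apply: seg_lt; exact: g_le.
Qed.

End Blocks.

Lemma play_type_blocks (g g' : nat -> nat) P Q P' Q' :
  (forall i, g i < g i.+1)%N -> (forall i, g' i < g' i.+1)%N ->
  (forall i, play_type (blocks g i) P Q = play_type (blocks g' i) P' Q') ->
  play_type (\bigcup_i D i) P Q = play_type (\bigcup_i D i) P' Q'.
Proof.
move=> gl gl' e; rewrite -{1}(bigcup_blocks gl) -(bigcup_blocks gl').
by apply: type_of_bigcup => //; apply: ordered_blocks.
Qed.

Lemma play_type_seg_right P Q k k' m m' :
  (k <= m)%N -> (k' <= m)%N -> (m <= m')%N ->
  play_type (seg k m) P Q = play_type (seg k' m) P Q ->
  play_type (seg k m') P Q = play_type (seg k' m') P Q.
Proof.
move=> km km' mm' e; rewrite (segU km mm') (segU km' mm').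
by apply: type_of_setU => // x y; apply: seg_lt.
Qed.

(** A round of the omega-game: a demand of player I, answered by player II with the moves of both
    players on the current piece. *)
Let M := (set ty * (set T * set T))%type.
Implicit Types (x y : nat -> M) (h : seq M).

Definition play1 x := glue D (fun i => (x i).2.1).
Definition play2 x := glue D (fun i => (x i).2.2).

Definition seg_type x k m := play_type (seg k m) (play1 x) (play2 x).

Lemma seg_type_eq x y k m : (forall i, (i < m)%N -> x i = y i) ->
  seg_type x k m = seg_type y k m.
Proof.
move=> e; apply: play_type_local => z [i im Dz];
  by rewrite /play1 /play2 !(glueE _ oD Dz) e //; lia.
Qed.

Definition nth_move h i : M := nth (set0, (set0, set0)) (rev h) i.

Lemma nth_move_cons m h i : (i < size h)%N -> nth_move (m :: h) i = nth_move h i.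
Proof. by move=> ih; rewrite /nth_move rev_cons nth_rcons size_rev ih. Qed.

Lemma nth_move_history x i n' : (i < n')%N -> nth_move (history x n') i = x i.
Proof.
elim: n' => // n' IH; rewrite ltnS leq_eqVlt => /orP[/eqP ->|ni].
  by rewrite /nth_move /= rev_cons nth_rcons size_rev size_history ltnn eqxx.
by rewrite /= nth_move_cons ?size_history //; apply: IH.
Qed.

(** * The payoff of the omega-game is Sigma^0_3 *)

Section Payoff.
Variable C : set ty.

(** One play suffices: by composition, all plays that factor into a block of type [s] followed by
    blocks of type [e] have the same type. *)
Definition linked_pair (s e : ty) := exists P Q (g : nat -> nat),
  [/\ forall i, (g i < g i.+1)%N, play_type (seg 0 (g 0%N)) P Q = s,
      forall i, play_type (seg (g i) (g i.+1)) P Q = e &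
      C (play_type (\bigcup_i D i) P Q)].

(** An open condition: a finite history shows that [k] merges with an index beyond [N], with types
    that form a linked pair. *)
Definition winning_return k N h := exists m m',
  [/\ (maxn k N < m)%N, (m < m')%N, (m' <= size h)%N,
      linked_pair (seg_type (nth_move h) 0 k) (seg_type (nth_move h) k m) &
      seg_type (nth_move h) k m' = seg_type (nth_move h) m m'].

Lemma winning_return_up k N a h : winning_return k N h -> winning_return k N (a :: h).
Proof.
move=> [m [m' [Nm mm' m'h l e]]]; exists m, m'.
have eqh i j : (j <= m')%N ->
    seg_type (nth_move (a :: h)) i j = seg_type (nth_move h) i j.
  by move=> jm; apply: seg_type_eq => l' lj; apply: nth_move_cons; lia.
rewrite !eqh ?(ltnW mm') //; last by lia.
by split=> //; exact: leqW.
Qed.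

Lemma winning_return_history k N x i : winning_return k N (history x i) <->
  exists m m', [/\ (maxn k N < m)%N, (m < m')%N, (m' <= i)%N,
      linked_pair (seg_type x 0 k) (seg_type x k m) &
      seg_type x k m' = seg_type x m m'].
Proof.
have eqh l j : (j <= i)%N -> seg_type (nth_move (history x i)) l j = seg_type x l j.
  by move=> ji; apply: seg_type_eq => l' lj; apply: nth_move_history; lia.
split=> -[m [m' [Nm mm' m'h l e]]]; exists m, m'; rewrite ?size_history in m'h *;
  rewrite ?eqh in l e *; by [|lia].
Qed.

(** Forwards, Ramsey's theorem supplies [k] and the returns. Backwards, infinitely many returns
    share one type [e] by pigeonhole, which yields a factorization from [k] whose types form a
    linked pair. *)
Lemma payoff_sigma03 x : C (play_type (\bigcup_i D i) (play1 x) (play2 x)) <->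
  exists k, forall N, exists i, winning_return k N (history x i).
Proof.
have c_right k k' m m' : (k <= m)%N -> (k' <= m)%N -> (m <= m')%N ->
    seg_type x k m = seg_type x k' m -> seg_type x k m' = seg_type x k' m'.
  exact: play_type_seg_right.
split=> [Cx|[k kP]].
  have [k [e ke]] := merging_ramsey (seg_type x); exists k => N.
  have [g [gk g_lt ge]] := merging_factorization c_right ke.
  have [m [m' [Nm mm' em em']]] := ke (maxn k N).
  exists m'; apply/winning_return_history; exists m, m'; split=> //.
  by exists (play1 x), (play2 x), g; rewrite gk em; split.
have {kP} : forall N, exists2 m, (N < m)%N & (exists2 m', (m < m')%N &
      seg_type x k m' = seg_type x m m') /\
      linked_pair (seg_type x 0 k) (seg_type x k m).
  move=> N; have [i /winning_return_history[m [m' [Nm mm' _ l e]]]] := kP N.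
  by exists m; [lia|split=> //; exists m'].
move=> /(infinite_pigeonhole (seg_type x k))[e eP].
have [g [gk g_lt ge]] : exists g : nat -> nat, [/\ g 0%N = k,
    forall i, (g i < g i.+1)%N & forall i, seg_type x (g i) (g i.+1) = e].
  apply: (merging_factorization c_right) => N.
  by have [m Nm [[[m' mm' em'] _] em]] := eP N; exists m, m'.
have [m _ [[_ +] em]] := eP 0%N; rewrite em => -[P [Q [g' [g'_lt s' e' CPQ]]]].
rewrite (play_type_blocks (g := g) (g' := g') (P' := P) (Q' := Q)) //.
case=> [|i] /=; first by rewrite s' gk.
by rewrite e'; exact: ge.
Qed.

End Payoff.

(** * Transfer of strategies from the omega-game *)

Hypothesis detD : forall i, determined (D i).

Definition demand i (W : set ty) := if `[< forced1 (D i) W >] then W else setT.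

Lemma forced1_demand i W : forced1 (D i) (demand i W).
Proof.
rewrite /demand; case: asboolP => // _.
by exists (fun=> set0); split.
Qed.

Definition demand_met h : Prop :=
  if h is (W, (P, Q)) :: h' then demand (size h') W (play_type (D (size h')) P Q)
  else True.

(** The demands made by the winning strategy are enforced piece by piece; what is then played on a
    piece is a legal answer to the demand. *)
Lemma forced1_bigcup (C : set ty) :
  wins_from demand_met
    (fun x => C (play_type (\bigcup_i D i) (play1 x) (play2 x))) [::] ->
  forced1 (\bigcup_i D i) C.
Proof.
move=> [s sP]; have /choice[F FP] iW := forced1_demand iW.1 iW.2.
pose f h := F (size h, s h).
pose step h Z : M := (s h, (f h Z, Z)).
pose x := sum_play step.
have sizeh Z i : size (sum_history step Z i) = i by rewrite -history_sum_play size_history.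
exists (fun Z => glue D (fun i => f (sum_history step Z i) (Z `&` D i))); split.
  apply: (@causal_sum M step (fun y x : T => y < x) f) => //.
    by move=> z y t yt zy; apply: lt_le_trans zy yt.
  by move=> h; apply: (FP _).1.
move=> Q.
have -> : play_type (\bigcup_i D i) (glue D (fun i => f (sum_history step Q i) (Q `&` D i))) Q
        = play_type (\bigcup_i D i) (play1 (x Q)) (play2 (x Q)).
  apply: play_type_local => [//|z [i _ Dz]].
  by rewrite /play2 (glueE _ oD Dz) /=; split=> [|[]].
apply: sP => [|i _]; last by rewrite history_sum_play.
split=> // i _; rewrite /= history_sum_play sizeh.
by have := (FP (i, s (sum_history step Q i))).2 (Q `&` D i); rewrite /f sizeh.
Qed.

(** On each piece player II can force a type with which [t] answers some demand. Once the piece is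
    played, such a demand is inserted into an auxiliary omega-play following [t]. Both plays have
    equal types on each piece, hence on the union. *)
Lemma forced2_bigcup (C : set ty) (t : seq M -> set ty -> set T * set T) (R : set (seq M)) :
  R [::] ->
  (forall h W, R h -> demand_met ((W, t h W) :: h) /\ R ((W, t h W) :: h)) ->
  (forall x, (forall i, (x i).2 = t (history x i) (x i).1) ->
     ~ C (play_type (\bigcup_i D i) (play1 x) (play2 x))) ->
  forced2 (\bigcup_i D i) (~` C).
Proof.
move=> R0 Rt tC.
pose answers h : set ty := fun v =>
  exists W, v = play_type (D (size h)) (t h W).1 (t h W).2.
(* If player I could avoid every answer of [t] at [h], then avoiding them
   would be a demand which [t] answers in contradiction with [demand_met]. *)
have answers_forced h : R h -> forced2 (D (size h)) (answers h).
  move=> Rh; case: (detD (size h) (~` answers h)) => [f1|]; last by rewrite setCK.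
  have [+ _] := Rt h (~` answers h) Rh.
  rewrite /=; case E: (t _ _) => [P Q]; rewrite /demand asboolT //.
  by case; exists (~` answers h); rewrite E.
have /choice[G GP] : forall h, exists f : set T -> set T, causal f /\
    (R h -> forall P, answers h (play_type (D (size h)) P (f P))).
  move=> h; case: (pselect (R h)) => [/answers_forced[f [cf fP]]|nR].
    by exists f.
  by exists (fun=> set0).
have /choice[W WP] : forall hv : seq M * ty, exists W, answers hv.1 hv.2 ->
    hv.2 = play_type (D (size hv.1)) (t hv.1 W).1 (t hv.1 W).2.
  move=> hv; case: (pselect (answers hv.1 hv.2)) => [[W e]|na]; first by exists W.
  by exists set0.
pose step h Z : M :=
  let V := W (h, play_type (D (size h)) Z (G h Z)) in (V, t h V).
pose x := sum_play step.
have sizeh Z i : size (sum_history step Z i) = i by rewrite -history_sum_play size_history.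
have Rx Z i : R (sum_history step Z i) 
  by elim: i => //= i Ri; apply: (Rt _ _ Ri).2.
exists (fun Z => glue D (fun i => G (sum_history step Z i) (Z `&` D i))); split.
  apply: (@causal_sum M step (fun y x : T => y <= x) G) => [y z /ltW //|z y t' yt zy|h].
    exact: le_trans zy yt.
  exact: (GP _).1.
move=> P; suff -> : play_type (\bigcup_i D i) P
    (glue D (fun i => G (sum_history step P i) (P `&` D i))) =
    play_type (\bigcup_i D i) (play1 (x P)) (play2 (x P)).
  by apply: tC => i; rewrite history_sum_play.
apply: type_of_bigcup => // i; rewrite -!/(play_type _ _ _).
set h := sum_history step P i.
have := WP (h, _) ((GP h).2 (Rx P i) (P `&` D i)); rewrite /= sizeh => e.
transitivity (play_type (D i) (P `&` D i) (G h (P `&` D i))).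
  by apply: play_type_local => z Dz; [split=> [|[]]|rewrite (glueE _ oD Dz)].
rewrite e; apply: play_type_local => z Dz;
  by rewrite /play1 /play2 (glueE _ oD Dz) /x /sum_play /step -/h /= sizeh.
Qed.

Lemma determined_bigcup : determined (\bigcup_i D i).
Proof.
move=> C.
have [||w|[t [R [R0 Rt tC]]]] := @sigma03_determined (set ty) (set T * set T)%type setT
  demand_met (fun x => C (play_type (\bigcup_i D i) (play1 x) (play2 x)))
  (winning_return C).
- by move=> k m a h; apply: winning_return_up.
- by move=> x; apply: payoff_sigma03.
- by left; apply: forced1_bigcup.
- by right; apply: forced2_bigcup R0 Rt tC.
Qed.

End OmegaSum.

(** * Induction over countable well-orders *)

Lemma determined_setU (b : T) D E : (forall x y, D x -> E y -> x < y) ->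
  determined D -> determined E -> determined (D `|` E).
Proof.
move=> DE dD dE; rewrite -bigcup_two_pieces.
apply: determined_bigcup; first exact: ordered_two_pieces.
by case=> [|[|i]] //=; apply: (@determined_sub1 _ b).
Qed.

(** [F i] collects the points of [D] whose first upper bound in [D] along the enumeration is [e i].
    These ordered pieces are either empty or bounded by a point of [D]. *)
Lemma determined_locally (e : nat -> T) D : (forall x, exists i, e i = x) ->
  (forall c E, D c -> E `<=` [set x | x <= c] -> determined E) -> determined D.
Proof.
move=> eT detE.
pose F i : set T := fun x => [/\ D x, D (e i), x <= e i &
  forall j, (j < i)%N -> D (e j) -> e j < x].
have -> : D = \bigcup_i F i.
  apply/seteqP; split=> [x Dx|x [i _ []] //].
  have ex : exists i, `[< D (e i) /\ x <= e i >].
    by have [i ei] := eT x; exists i; apply/asboolP; rewrite ei.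
  case: (ex_minnP ex) => i /asboolP[Di xi] min; exists i => //; split=> // j ji Dj.
  rewrite ltNge; apply/negP => xj.
  have /min : `[< D (e j) /\ x <= e j >] by apply/asboolP.
  by rewrite leqNgt ji.
apply: determined_bigcup.
  by move=> i j ij x y [_ Di xi _] [_ _ _ /(_ i ij Di)]; apply: le_lt_trans.
move=> i; case: (pselect (D (e i))) => Di.
  by apply: (detE (e i)) => // x [].
by apply: (@determined_sub1 _ (e i)) => x [].
Qed.

Lemma determined_countable : well_ordered T -> countable [set: T] ->
  [set: T] !=set0 -> forall D, determined D.
Proof.
move=> wo /countable_injP[f finj] [b _].
have /choice[e eP] : forall i, exists x, forall y, f y = i -> y = x.
  move=> i; case: (pselect (exists x, f x = i)) => [[x fx]|nx].
    by exists x => y fy; apply: finj; rewrite ?inE // fy.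
  by exists b => y fy; case: nx; exists y.
have eT x : exists i, e i = x by exists (f x); apply/esym/eP.
suff det c E : E `<=` [set x | x <= c] -> determined E.
  by move=> D; apply: (determined_locally eT) => c E _; apply: det.
elim/(well_founded_ind wo): c E => c IH E Ec.
(* With the possible top point split off, every local bound is smaller than [c] and the induction
   hypothesis applies. *)
have -> : E = (E `&` [set x | x < c]) `|` (E `&` [set c]).
  apply/seteqP; split=> [x Ex|x [] [] //].
  by have := Ec _ Ex; rewrite /= le_eqVlt => /orP[/eqP xc|xc]; [right|left]; split.
apply: (determined_setU b) => [x y [_ xc] [_ ->] //||].
  by apply: (determined_locally eT) => c' E' [_ c'c]; apply: IH.
by apply: (@determined_sub1 _ c) => x [].
Qed.

End Determinacy.

Theorem theorem6p2 (d : Order.disp_t) (T : orderType d)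
  (T_wo : well_ordered T)
  (T_countable : countable [set: T])
  (T_nonempty : [set: T] !=set0) :
  determinate T.
Proof.
move=> phi; pose n := qdepth phi.
(* Types of depth [n] decide [phi], so player I wins exactly the plays with type in [C]. *)
pose C : set (mso_type n 2) := fun t =>
  exists P Q : set T, t = play_type n setT P Q /\ player1_wins phi P Q.
have CP (P Q : set T) : C (play_type n setT P Q) <-> player1_wins phi P Q.
  split=> [[P' [Q' [e]]]|w]; last by exists P, Q.
  apply: (@sat_type_of _ _ 0 2 phi n 2 (fun=> 0%N) val _ _ _ _ _ _ _ _ _ _ _ _ _ (esym e)) => //.
  - exact: ltn_ord.
  - by case.
  - by case=> -[|[|]].
  - by case.
  - by case=> -[|[|]].
have [[f [cf fC]]|[f [cf fC]]] := determined_countable T_wo T_countable T_nonempty setT C.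
- by left; exists f; split=> // Q; apply/CP.
- by right; exists f; split=> // P /CP; apply: fC.
Qed.
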